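(* Let $V$ be a finite set and let $(B,B')$ be an edge pair of subsets of $V$. Let $(J_B,J_{B'})\in\mathbb{R}^2$. The following two statements are equivalent: (i) for any $\epsilon>0$ there is a choice of $w_B=(w_i)_{i\in B}\in\mathbb{R}^B$ and $c\in\mathbb{R}$ such that $\|(K_B,K_{B'})-(J_B,J_{B'})\|\le\epsilon$; (ii) depending on $|B|$: - if $|B|=1$: $J_{B'}\ge0$ and $J_{B'}\ge-J_B$; - if $|B|=2$ or $|B|=3$: either ($J_{B'}\ge0$ and $J_{B'}\ge-J_B$) or ($J_{B'}\le0$ and $J_{B'}\le-J_B$); - if $|B|\ge4$: no condition, i.e. $(J_B,J_{B'})\in\mathbb{R}^2$ is arbitrary.
   Context: An edge pair $(B,B')$ is a pair of sets such that $B\supsetneq B'$ and there is no set $C$ with $B\supsetneq C\supsetneq B'$. For $w=(w_i)_{i\in V}\in\mathbb{R}^V$ and $c\in\mathbb{R}$, the coefficients $K_C=K_C(w,c)$ of the soft-plus unit $\{0,1\}^V\to\mathbb{R}$, $x\mapsto\log(1+\exp(\sum_{i\in V}w_ix_i+c))=\sum_{C\subseteq V}K_C\prod_{i\in C}x_i$ are $$K_C(w,c)=\sum_{A\subseteq C}(-1)^{|C\setminus A|}\log\Big(1+\exp\Big(\sum_{i\in A}w_i+c\Big)\Big),\quad C\subseteq V.$$ $K_C$ depends only on $c$ and $w_i$, $i\in C$; so $K_B$ and $K_{B'}$ depend only on $w_B$ and $c$. $\|\cdot\|$ is the Euclidean norm on $\mathbb{R}^2$. *)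

(* Defs.v *)
From HB Require Import structures.
From mathcomp Require Import all_boot all_order all_algebra.
From mathcomp Require Import reals sequences exp.

Set Implicit Arguments.
Unset Strict Implicit.
Unset Printing Implicit Defensive.

Import Order.TTheory GRing.Theory Num.Theory.
Local Open Scope ring_scope.

Definition edge_pair (V : finType) (B B' : {set V}) : Prop :=
  B' \proper B /\ ~ exists C : {set V}, B' \proper C /\ C \proper B.

Definition softplus_coef (R : realType) (V : finType)
    (w : V -> R) (c : R) (C : {set V}) : R :=
  \sum_(A : {set V} | A \subset C)
    (-1) ^+ #|C :\: A| * ln (1 + expR (\sum_(i in A) w i + c)).

(* A weight vector in R^B is extended by zero to R^V; by softplus_coef_local,
   the values outside B are irrelevant to the coefficients of subsets of B. *)
Definition extend0 (R : realType) (V : finType) (B : {set V})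
    (w : {i : V | i \in B} -> R) (i : V) : R :=
  if insub i is Some j then w j else 0.

Lemma softplus_coef_local (R : realType) (V : finType) (w w' : V -> R) (c : R)
    (C : {set V}) :
  {in C, w =1 w'} -> softplus_coef w c C = softplus_coef w' c C.
Proof.
move=> eqw; apply: eq_bigr => A /subsetP sAC.
by congr (_ * ln (1 + expR (_ + c))); apply: eq_bigr => i /sAC /eqw.
Qed.

(* The library norm on R * R is the sup norm, hence this definition. *)
Definition euclid_norm (R : realType) (x : R * R) : R :=
  Num.sqrt (x.1 ^+ 2 + x.2 ^+ 2).

(* Main.v *)
Require Import Defs.
From HB Require Import structures.
From mathcomp Require Import all_boot all_order all_algebra.
From mathcomp Require Import ring lra.
From mathcomp Require Import reals topology normedtype.
From mathcomp Require Import sequences exp.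

Set Implicit Arguments.
Unset Strict Implicit.
Unset Printing Implicit Defensive.

Import Order.TTheory GRing.Theory Num.Theory.
Import numFieldNormedType.Exports.
Local Open Scope ring_scope.

(**
Write B = i |: B'. As a function of the bias, F(c) = K_B'(w, c) is the iterated
finite difference, with steps w_j for j in B', of the soft-plus function
s(x) = log(1 + exp x), so K_B(w, c) = F(c + w_i) - F(c)
([softplus_coefU1]). Since w_i is free, (K_B', K_B + K_B') ranges exactly over
the pairs (F x, F y) with x and y arbitrary, and the first statement of the
equivalence says that (J_B', J_B + J_B') lies in the closure of the set of
these pairs ([approx_edge_pair]). What remains is to find out which pairs of
values a finite difference of s of order |B'| can take.

Necessity. If |B'| <= 2, then F has a constant sign, because s is positive,
increasing and convex ([softplus_coef_sign]); for |B'| = 0 that sign is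
positive. Hence the pairs (F x, F y) stay in the first or the third quadrant,
and the union of these two quadrants is closed.

Sufficiency. Take all weights equal to a large t >= 0. At this scale s differs
from x |-> max(x, 0) by a bounded amount, so F is, up to an error
bounded independently of t, an iterated difference of max(x, 0). F tends to 0
at -oo ([softplus_coef_const_small]) and, with n = |B'| and up to such an error,
- at c = t (1 - n) only A = B' contributes, so F is about t
  ([softplus_coef_const_ge]);
- at c = t (2 - n) only A = B' and the n sets of size n - 1 contribute, and
  F is about 2 t - n t, which is at most - t if n >= 3
  ([softplus_coef_const_le]).
By the intermediate value theorem one F takes any two prescribed positive
values, and any two prescribed real values if n >= 3. If n >= 1, reversing the
sign of one weight changes F into a translate of -F ([softplus_coef_opp]),
which gives the pairs of negative values. When n <= 2, targets on the boundary
of a quadrant are approached from its interior.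
*)

(** * The soft-plus function *)

Section Softplus.
Variable R : realType.
Implicit Types x y u v : R.

Definition softplus x : R := ln (1 + expR x).

Let gt0_1DexpR x : 0 < 1 + expR x.
Proof. by rewrite addr_gt0 ?expR_gt0. Qed.

Lemma softplus_ge0 x : 0 <= softplus x.
Proof. by rewrite ln_ge0// lerDl expR_ge0. Qed.

Lemma softplus_le_expR x : softplus x <= expR x.
Proof. by apply: le_ln1Dx; rewrite (lt_trans _ (expR_gt0 x))// ltrN10. Qed.

Lemma softplus_le1 x : x <= 0 -> softplus x <= 1.
Proof.
by move=> x0; rewrite (le_trans (softplus_le_expR x))// expR_le1.
Qed.

(** The function s(x) - max(x, 0) is even; this transports bounds on the
    negative half-line to the positive one. *)
Lemma softplus_opp x : softplus x = x + softplus (- x).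
Proof.
rewrite -{2}(expRK x) /softplus -lnM ?posrE ?expR_gt0 ?gt0_1DexpR//.
by rewrite mulrDr mulr1 -expRD subrr expR0 addrC.
Qed.

Lemma softplus_ge x : x <= softplus x.
Proof. by rewrite softplus_opp lerDl softplus_ge0. Qed.

Lemma softplus_le_add1 x : 0 <= x -> softplus x <= x + 1.
Proof. by move=> x0; rewrite softplus_opp lerD2l softplus_le1// oppr_le0. Qed.

Lemma softplus_mono : {mono softplus : x y / x <= y}.
Proof.
by move=> x y; rewrite ler_ln ?posrE ?gt0_1DexpR// lerD2l ler_expR.
Qed.

Lemma continuous_softplus : continuous softplus.
Proof.
move=> x; apply: (@continuous_comp _ _ _ (fun x => 1 + expR x) (@ln R)).
  by apply: continuousD; [exact: cst_continuous|exact: continuous_expR].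
by apply: continuous_ln; exact: gt0_1DexpR.
Qed.

(* The sign of a second difference of soft-plus is that of
   (exp u - 1) (exp v - 1), whatever the base point x. *)
Let expR_diff x u v :
  (1 + expR (x + u + v)) * (1 + expR x) -
  (1 + expR (x + u)) * (1 + expR (x + v)) =
  expR x * ((expR u - 1) * (expR v - 1)).
Proof. by rewrite !expRD; ring. Qed.

(** Convexity of soft-plus; the steps may also both be negative, as the product
    (exp u - 1) (exp v - 1) has the sign of u v. *)
Lemma softplus_diff2_ge0 x u v : 0 <= u * v ->
  softplus (x + u) + softplus (x + v) <= softplus (x + u + v) + softplus x.
Proof.
move=> uv.
rewrite -!lnM ?posrE ?gt0_1DexpR// ler_ln ?posrE ?mulr_gt0 ?gt0_1DexpR//.
rewrite -subr_ge0 expR_diff mulr_ge0 ?expR_ge0//.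
have [u0|u0|u0] := ltgtP 0 u; last by rewrite -u0 expR0 subrr mul0r.
- move: uv; rewrite pmulr_rge0// => v0.
  by rewrite mulr_ge0// subr_ge0 -expR0 ler_expR// ltW.
- move: uv; rewrite nmulr_rge0// => v0.
  by rewrite mulr_le0// subr_le0 -expR0 ler_expR// ltW.
Qed.

(** This is the previous inequality at x + u, with the steps - u and v. *)
Lemma softplus_diff2_le0 x u v : u * v <= 0 ->
  softplus (x + u + v) + softplus x <= softplus (x + u) + softplus (x + v).
Proof.
move=> uv; have := @softplus_diff2_ge0 (x + u) (- u) v.
by rewrite mulNr oppr_ge0 addrK => /(_ uv); lra.
Qed.

End Softplus.

(** * Coefficients as iterated finite differences *)

Section Coefficients.
Variables (R : realType) (V : finType).
Implicit Types (w : V -> R) (c x y a t : R) (C : {set V}) (i : V).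

Lemma edge_pair_setU1 (B B' : {set V}) :
  edge_pair B B' -> exists2 i, i \notin B' & B = i |: B'.
Proof.
case=> /properP[sB'B [i iB iB']] noC; exists i => //.
apply/eqP; rewrite eq_sym eqEproper subUset sub1set iB sB'B/=.
by apply/negP => ltB; apply: noC; exists (i |: B'); rewrite properUr ?sub1set.
Qed.

Lemma softplus_coef0 w c : softplus_coef w c set0 = softplus c.
Proof.
rewrite /softplus_coef (big_pred1 set0) => [|A]; last by rewrite subset0.
by rewrite setD0 cards0 mul1r big_set0 add0r.
Qed.

(** Each element of C contributes a finite difference in the bias: the subsets
    containing i shift c by w i, the others carry the opposite sign. *)
Lemma softplus_coefU1 w c C i : i \notin C ->
  softplus_coef w c (i |: C) =
  softplus_coef w (c + w i) C - softplus_coef w c C.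
Proof.
move=> iC; rewrite /softplus_coef (bigID (fun A : {set V} => i \in A))/=.
congr (_ + _); last first.
  rewrite -sumrN; apply: eq_big => [A|A /andP[_ iA]].
    apply/andP/idP => [[/subsetP sA iA]|sA]; last first.
      rewrite subsetU ?sA ?orbT//; split=> //.
      by apply: contraNN iC; apply/(subsetP sA).
    apply/subsetP => j jA; move: (sA _ jA); rewrite !inE => /orP[/eqP ji|//].
    by rewrite -ji jA in iA.
  have -> : (i |: C) :\: A = i |: (C :\: A).
    by apply/setP => j; rewrite !inE; case: eqP => // ->; rewrite (negbTE iA).
  by rewrite cardsU1 !inE (negbTE iC) andbF exprS mulN1r mulNr.
rewrite (reindex_onto (fun A => i |: A) (fun A => A :\ i)) /=; last first.
  by move=> A /andP[_ iA]; rewrite setD1K.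
apply: eq_big => [A|A /andP[/andP[_ _] /eqP Ai]].
  apply/idP/idP => [/andP[/andP[/subsetP sA _] /eqP Ai]|sA].
    apply/subsetP => j jA.
    have ji : j != i by apply: contraTneq jA => ->; rewrite -Ai !inE eqxx.
    by have := sA j; rewrite !inE jA (negbTE ji) orbT => /(_ isT).
  have iA : i \notin A by apply: contraNN iC; exact/(subsetP sA).
  by rewrite setUS// setU11 setU1K/=.
have iA : i \notin A by rewrite -Ai !inE eqxx.
congr ((-1) ^+ #|pred_of_set _| * ln (1 + expR _)).
  apply/setP => j; rewrite !inE; case: eqP => //= ->.
  by rewrite (negbTE iC) andbF.
by rewrite big_setU1//=; ring.
Qed.

(** A difference with step - h is the opposite of the difference with step h
    based at the shifted point. *)
Lemma softplus_coef_opp w c C i : i \in C ->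
  softplus_coef w c C =
  - softplus_coef (fun j => if j == i then - w j else w j) (c + w i) C.
Proof.
move=> iC; rewrite -(setD1K iC) !softplus_coefU1 ?setD11// eqxx addrK opprB.
by congr (_ - _); apply: softplus_coef_local => j;
  rewrite !inE => /andP[/negbTE ->].
Qed.

Lemma continuous_softplus_coef w C :
  continuous (fun c => softplus_coef w c C).
Proof.
suff cs (A : {set V}) : A \subset C -> continuous
    (fun c => (-1) ^+ #|C :\: A| * softplus (\sum_(i in A) w i + c)).
  exact: (continuous_big (@add_continuous R) cs).
move=> _ x; apply: (@continuousM _ _ (fun=> _) (fun c => softplus (_ + c))).
  exact: cst_continuous.
apply: (@continuous_comp _ _ _ (+%R (\sum_(i in A) w i)) (@softplus R)).
  by apply: continuousD; [exact: cst_continuous|exact: cvg_id].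
exact: continuous_softplus.
Qed.

Lemma softplus_coef_IVT w C x y a :
  softplus_coef w x C <= a <= softplus_coef w y C ->
  exists z, softplus_coef w z C = a.
Proof.
move=> a_xy; have ct (I : classical_sets.set R) := continuous_subspaceT (A := I)
  (@continuous_softplus_coef w C).
have /andP[xa ay] := a_xy.
have [xy|/ltW yx] := leP x y.
- have [|z _ <-] := IVT (v := a) xy (ct _); last by exists z.
  by rewrite ge_min xa le_max ay orbT.
- have [|z _ <-] := IVT (v := a) yx (ct _); last by exists z.
  by rewrite ge_min xa orbT le_max ay.
Qed.

(** Positivity, monotonicity and convexity of soft-plus, for differences of
    order 0, 1 and 2; differences of order 3 do change sign. *)
Lemma softplus_coef_sign w C : (#|C| <= 2)%N ->
  (forall c, 0 <= softplus_coef w c C) \/ (forall c, softplus_coef w c C <= 0).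
Proof.
case E : #|C| => [|[|[|//]]] _.
- left=> c; move/eqP: E; rewrite cards_eq0 => /eqP ->.
  by rewrite softplus_coef0 softplus_ge0.
- have /eqP/cards1P[i ->] := E; rewrite -(setU0 [set i]).
  have [w0|/ltW w0] := leP 0 (w i); [left=> c|right=> c];
    rewrite softplus_coefU1 ?inE// !softplus_coef0.
  + by rewrite subr_ge0 softplus_mono lerDl.
  + by rewrite subr_le0 softplus_mono gerDl.
- have /eqP/cards2P[i [j [ij ->]]] := E; rewrite -(setU0 [set j]).
  have [w0|/ltW w0] := leP 0 (w i * w j); [left=> c|right=> c];
    rewrite !softplus_coefU1 ?inE ?orbF ?ij// !softplus_coef0.
  + by have := softplus_diff2_ge0 c w0; lra.
  + by have := softplus_diff2_le0 c w0; lra.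
Qed.

(** * Range of a coefficient with equal weights *)

Section EqualWeights.
Variables (C : {set V}) (t : R).
Let n : R := #|C|%:R.
(* N bounds the number of terms of any sum over subsets of C. *)
Let N : R := #|{set V}|%:R.

Local Notation F c := (softplus_coef (fun=> t) c C).

Lemma softplus_coef_const c :
  F c = \sum_(A : {set V} | A \subset C)
    (-1) ^+ #|C :\: A| * softplus (t * #|A|%:R + c).
Proof. by apply: eq_bigr => A _; rewrite sumr_const mulr_natr. Qed.

(** Serves to discard the terms whose soft-plus argument is nonpositive, and
    the whole sum when c is very negative. *)
Lemma norm_sum_softplus_le (P : pred {set V}) (k : {set V} -> nat)
    (z : {set V} -> R) a : 0 <= a ->
  (forall A, P A -> softplus (z A) <= a) ->
  `|\sum_(A | P A) (-1) ^+ k A * softplus (z A)| <= N * a.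
Proof.
move=> a0 za; apply: (le_trans (ler_norm_sum _ _ _)).
apply: (@le_trans _ _ (\sum_(A : {set V}) a)); last first.
  by rewrite sumr_const mulr_natl.
rewrite big_mkcond ler_sum// => A _; case: ifPn => // PA.
by rewrite normrM normrX normrN1 expr1n mul1r ger0_norm ?softplus_ge0 ?za.
Qed.

Hypothesis t0 : 0 <= t.

Lemma softplus_coef_const_small a : 0 < a -> exists c, `|F c| <= a.
Proof.
move=> a0; have N0 : 0 < N.
  by rewrite ltr0n; apply/card_gt0P; exists set0.
(* With this bias each soft-plus argument is at most ln (a / N). *)
exists (ln (a / N) - t * n); rewrite softplus_coef_const.
rewrite [leRHS](_ : a = N * (a / N)); last by rewrite mulrC divfK ?gt_eqF.
apply: norm_sum_softplus_le => [|A sA]; first by rewrite divr_ge0// ltW.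
apply: (le_trans (softplus_le_expR _)).
rewrite -[leRHS]lnK ?posrE ?divr_gt0// ler_expR addrCA gerDl subr_le0.
by rewrite ler_wpM2l// ler_nat subset_leq_card.
Qed.

(** The arguments are t (|A| + 1 - n): equal to t for A = C, nonpositive for
    every proper subset. *)
Lemma softplus_coef_const_ge : t - N <= F (t * (1 - n)).
Proof.
rewrite softplus_coef_const (bigD1 C)//= setDv cards0 expr0 mul1r.
have -> : t * #|C|%:R + t * (1 - n) = t by rewrite /n; ring.
rewrite -[N]mulr1 lerD ?softplus_ge// lerNl.
apply: (le_trans (ler_norm _)); rewrite normrN.
apply: norm_sum_softplus_le => // A sA; apply: softplus_le1.
have ltA : (#|A| < #|C|)%N by rewrite proper_card// properEneq andbC.
rewrite -mulrDr mulr_ge0_le0//.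
by rewrite addrA subr_le0 natr1 ler_nat.
Qed.

(** The arguments are t (|A| + 2 - n): equal to 2 t for A = C, to t for the n
    subsets of size n - 1, which have sign -1, and nonpositive otherwise. The
    main part of the sum is therefore (2 - n) t. *)
Lemma softplus_coef_const_le : (3 <= #|C|)%N ->
  F (t * (2 - n)) <= N + 1 - t.
Proof.
move=> C3; rewrite softplus_coef_const (bigD1 C)//= setDv cards0 expr0 mul1r.
have -> : t * #|C|%:R + t * (2 - n) = t * 2 by rewrite /n; ring.
rewrite (bigID (fun A : {set V} => #|A| == #|C|.-1))/=.
have -> : \sum_(A : {set V} | (A \subset C) && (A != C) && (#|A| == #|C|.-1))
      (-1) ^+ #|C :\: A| * softplus (t * #|A|%:R + t * (2 - n)) =
    - n * softplus t.
  have C0 : (0 < #|C|)%N := leq_trans (isT : 0 < 3)%N C3.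
  rewrite (eq_bigr (fun=> - softplus t)); last first.
    move=> A /andP[/andP[sA _] /eqP cA].
    rewrite cardsD (setIidPr sA) cA -subn1 subKn// expr1 mulN1r -mulrDr.
    by congr (- softplus _); rewrite natrB// /n; ring.
  rewrite (eq_bigl [in [set A : {set V} | A \subset C & #|A| == #|C|.-1]]).
    rewrite sumr_const cards_draws -{1}(prednK C0) binSn prednK//.
    by rewrite mulNr mulNrn mulr_natl.
  (* The condition A != C is implied by the size, as #|C|.-1 < #|C|. *)
  move=> A; rewrite inE; have [->|_] := eqVneq A C; last by rewrite andbT.
  by rewrite andbF -[X in X == _](prednK C0) gtn_eqF ?andbF.
have rest : `|\sum_(A : {set V} |
      (A \subset C) && (A != C) && (#|A| != #|C|.-1))
      (-1) ^+ #|C :\: A| * softplus (t * #|A|%:R + t * (2 - n))| <= N * 1.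
  apply: norm_sum_softplus_le => // A /andP[sA cA]; apply: softplus_le1.
  have ltA : (#|A| < #|C|)%N by rewrite proper_card// properEneq andbC.
  have {}ltA : (#|A|.+2 <= #|C|)%N.
    by rewrite ltn_neqAle ltA andbT; apply: contraNneq cA => <-.
  rewrite -mulrDr mulr_ge0_le0//.
  by rewrite addrA subr_le0 -natrD addn2 ler_nat.
have n3 : 3 <= n by rewrite ler_nat.
have s2 := softplus_le_add1 (mulr_ge0 t0 (ler0n R 2)).
have s1 : n * t <= n * softplus t by rewrite ler_wpM2l ?softplus_ge.
have nt : 3 * t <= n * t by rewrite ler_wpM2r.
by have := ler_norm (\sum_(A : {set V} |
      (A \subset C) && (A != C) && (#|A| != #|C|.-1))
      (-1) ^+ #|C :\: A| * softplus (t * #|A|%:R + t * (2 - n))); lra.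
Qed.

Lemma softplus_coef_const_pos a : 0 < a -> a + N <= t -> exists c, F c = a.
Proof.
move=> a0 at_; have [x xa] := softplus_coef_const_small a0.
apply: (@softplus_coef_IVT _ _ x (t * (1 - n))).
rewrite (le_trans (ler_norm _) xa) (le_trans _ softplus_coef_const_ge)//.
by rewrite lerBrDr.
Qed.

Lemma softplus_coef_const_onto a : (3 <= #|C|)%N -> `|a| + N + 1 <= t ->
  exists c, F c = a.
Proof.
move=> C3; have := ler_norm a; have := ler_norm (- a); rewrite normrN => ? ? ?.
apply: (@softplus_coef_IVT _ _ (t * (2 - n)) (t * (1 - n))).
by apply/andP; split; [have := softplus_coef_const_le C3|
  have := softplus_coef_const_ge]; lra.
Qed.

End EqualWeights.

(** * Pairs of values at two biases *)

(** Up to a linear change of coordinates, these are the pairs of coefficients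
    of i |: C and C, for i outside C. *)
Definition coef_values C a b :=
  exists w x y, softplus_coef w x C = a /\ softplus_coef w y C = b.

Lemma coef_values_gt0 C a b : 0 < a -> 0 < b -> coef_values C a b.
Proof.
move=> a0 b0; pose t : R := a + b + #|{set V}|%:R.
have t0 : 0 <= t by rewrite !addr_ge0// ltW.
have [||x xa] := @softplus_coef_const_pos C t t0 a => //.
  by rewrite lerD2r lerDl ltW.
have [||y yb] := @softplus_coef_const_pos C t t0 b => //.
  by rewrite lerD2r lerDr ltW.
by exists (fun=> t), x, y.
Qed.

Lemma coef_values_opp C a b : (0 < #|C|)%N ->
  coef_values C a b -> coef_values C (- a) (- b).
Proof.
move=> /card_gt0P[i iC] [w [x [y [<- <-]]]].
exists (fun j => if j == i then - w j else w j), (x + w i), (y + w i).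
by rewrite !(softplus_coef_opp w _ iC) !opprK.
Qed.

Lemma coef_values_all C a b : (3 <= #|C|)%N -> coef_values C a b.
Proof.
move=> C3; pose t : R := `|a| + `|b| + #|{set V}|%:R + 1.
have t0 : 0 <= t by rewrite !addr_ge0.
have [||x xa] := @softplus_coef_const_onto C t t0 a => //.
  by rewrite !lerD2r lerDl.
have [||y yb] := @softplus_coef_const_onto C t t0 b => //.
  by rewrite !lerD2r lerDr.
by exists (fun=> t), x, y.
Qed.

Lemma extend0_restrict w (B : {set V}) :
  {in B, extend0 (fun j : {i | i \in B} => w (val j)) =1 w}.
Proof. by move=> i iB; rewrite /extend0 insubT. Qed.

(** A pair (K_C, K_(i |: C)) is the same thing as the pair (F c, F (c + w i))
    of values of F = K_C, and w i is free as it does not affect F. The two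
    approximation statements then differ by a linear change of coordinates. *)
Lemma approx_edge_pair (C : {set V}) i (J J' : R) : i \notin C ->
  (forall eps : R, 0 < eps ->
     exists (w : {j | j \in i |: C} -> R) (c : R),
       euclid_norm ((softplus_coef (extend0 w) c (i |: C),
                     softplus_coef (extend0 w) c C) - (J, J')) <= eps) <->
  (forall eps : R, 0 < eps -> exists a b,
     [/\ coef_values C a b, `|a - J'| <= eps & `|b - (J + J')| <= eps]).
Proof.
move=> iC; split=> approx eps eps0.
- have [|w [c]] := approx (eps / 2); first by rewrite divr_gt0.
  rewrite softplus_coefU1// /euclid_norm/=.
  set a := softplus_coef _ c C; set b := softplus_coef _ _ C => le_eps.
  exists a, b.
  have : `|b - a - J| <= eps / 2 /\ `|a - J'| <= eps / 2.
    by split; apply: le_trans le_eps;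
      rewrite -sqrtr_sqr ler_wsqrtr// ?lerDl ?lerDr sqr_ge0.
  case; rewrite !ler_norml => /andP[? ?] /andP[? ?].
  split; [by exists (extend0 w), c, (c + extend0 w i)| |];
    by apply/andP; split; lra.
- have [|a [b [[w [x [y [wa wb]]]] aJ bJ]]] := approx (eps / 3).
    by rewrite divr_gt0.
  (* Only the weight of i is changed, so as to move the bias from x to y. *)
  pose w' j := if j == i then y - x else w j.
  have w'C : {in C, w' =1 w}.
    by move=> j jC; rewrite /w'; case: eqP => // ji; rewrite -ji jC in iC.
  exists (fun j => w' (val j)), x.
  rewrite !(@softplus_coef_local _ _ _ w') => [|j jC|]; first last.
  - exact: extend0_restrict.
  - by rewrite extend0_restrict// !inE jC orbT.
  have w'i : w' i = y - x by rewrite /w' eqxx.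
  rewrite softplus_coefU1// w'i [x + _]addrC subrK.
  rewrite !(softplus_coef_local _ w'C) wa wb /euclid_norm/=.
  rewrite -[eps]gtr0_norm// -sqrtr_sqr ler_wsqrtr//.
  move: aJ bJ; rewrite !ler_norml => /andP[? ?] /andP[? ?].
  (* The errors on K_C and on K_(i |: C) are at most eps / 3 and 2 eps / 3. *)
  by nra.
Qed.

End Coefficients.

Theorem lemma2 (R : realType) (V : finType) (B B' : {set V})
    (hBB' : edge_pair B B') (JB JB' : R) :
  (forall eps : R, 0 < eps ->
     exists (w : {i : V | i \in B} -> R) (c : R),
       euclid_norm ((softplus_coef (extend0 w) c B,
                     softplus_coef (extend0 w) c B') - (JB, JB')) <= eps)
  <->
  [/\ #|B| = 1%N -> JB' >= 0 /\ JB' >= - JB,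
      #|B| = 2%N \/ #|B| = 3%N ->
        (JB' >= 0 /\ JB' >= - JB) \/ (JB' <= 0 /\ JB' <= - JB)
    & (4 <= #|B|)%N -> True].
Proof.
have [i iB' ->] := edge_pair_setU1 hBB'.
have -> : (- JB <= JB') = (0 <= JB + JB') by rewrite -subr_ge0 opprK addrC.
have -> : (JB' <= - JB) = (JB + JB' <= 0) by rewrite -subr_le0 opprK addrC.
rewrite approx_edge_pair// cardsU1 iB' add1n; split.
- move=> approx; split=> // cB.
  + have /eqP : #|B'| = 0%N by case: cB.
    rewrite cards_eq0 => /eqP B'0.
    split; apply/ler_addgt0Pl => e e0;
      have [a [b [[w [x [y []]]]]]] := approx e e0;
      rewrite B'0 !softplus_coef0 => <- <- aJ bJ.
    * by have := softplus_ge0 x; move: aJ; rewrite ler_norml => /andP[? ?]; lra.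
    * by have := softplus_ge0 y; move: bJ; rewrite ler_norml => /andP[? ?]; lra.
  + have B'2 : (#|B'| <= 2)%N by case: cB => -[->].
    (* Nonzero coordinates of opposite signs keep their signs under a small
       perturbation, which the constant sign of F excludes. *)
    have opposite (p q : R) : (p = JB' /\ q = JB + JB') \/
        (p = JB + JB' /\ q = JB') -> 0 < p -> q < 0 -> False.
      move=> pq p0 q0.
      have [|a [b [[w [x [y [wa wb]]]]]]] := approx (Num.min p (- q) / 2).
        by rewrite divr_gt0// lt_min p0 oppr_gt0.
      set e := Num.min _ _.
      have ep : e <= p by rewrite ge_min lexx.
      have eq : e <= - q by rewrite ge_min lexx orbT.
      rewrite !ler_norml => /andP[? ?] /andP[? ?].
      by have [s|s] := softplus_coef_sign w B'2;
        have := s x; have := s y; rewrite wa wb; case: pq => -[? ?]; lra.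
    have h1 := opposite JB' (JB + JB') (or_introl (conj erefl erefl)).
    have h2 := opposite (JB + JB') JB' (or_intror (conj erefl erefl)).
    have {}h1 : JB + JB' < 0 -> JB' <= 0.
      by move=> q0; rewrite leNgt; apply/negP => p0; exact: h1.
    have {}h2 : JB' < 0 -> JB + JB' <= 0.
      by move=> q0; rewrite leNgt; apply/negP => p0; exact: h2.
    have [p0|p0] := leP 0 JB'; have [q0|q0] := leP 0 (JB + JB').
    * by left.
    * by right; rewrite h1// ltW.
    * by right; rewrite h2// ltW.
    * by right; rewrite !ltW.
- case=> c1 c23 _ eps eps0.
  have [B3|B2] := leqP 3 #|B'|.
    (* The target is itself a pair of values of F. *)
    exists JB', (JB + JB'); rewrite !subrr normr0 ltW//; split=> //.
    exact: coef_values_all.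
  have : (0 <= JB' /\ 0 <= JB + JB') \/
         [/\ (0 < #|B'|)%N, JB' <= 0 & JB + JB' <= 0].
    case E : #|B'| B2 => [|[|[|//]]] _; rewrite E in c1 c23.
    + by left; exact: c1.
    + by case: (c23 (or_introl erefl)) => -[]; [left|right].
    + by case: (c23 (or_intror erefl)) => -[]; [left|right].
  have addK (u v : R) : u + v - u = v by rewrite addrC addKr.
  case=> [[p0 q0]|[B'0 p0 q0]].
  (* Moving by eps into the open quadrant makes the target a pair of values. *)
  + exists (JB' + eps), (JB + JB' + eps).
    rewrite !addK gtr0_norm//; split=> //.
    by apply: coef_values_gt0; rewrite ltr_wpDl.
  + exists (JB' - eps), (JB + JB' - eps).
    rewrite !addK normrN gtr0_norm//; split=> //.
    rewrite -[JB' - eps]opprB -[JB + JB' - eps]opprB.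
    by apply: coef_values_opp => //; apply: coef_values_gt0;
      rewrite subr_gt0 (le_lt_trans _ eps0).
Qed.
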